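(* For every $\tau\in(0,\infty]$ and $0<\delta<1-\frac1{1+\tau}$ there exists a topological dynamical system $(X,f)$ satisfying the non-uniform $\tau$-specification property such that $\mathrm{Trans}(f)$ does not carry full topological entropy; more precisely, $$h_{top}^B(f,\mathrm{Trans}(f))\le\Big(\frac{1}{1+\tau}+\delta\Big)h_{top}(f)<h_{top}(f).$$ As a result, $h_{top}^B(f,\mathrm{Trans}(f))<h_{top}^B(f,\mathrm{Rec}(f))$.
   Context: Convention: $\frac1{1+\infty}=0$. A topological dynamical system $(X,f)$ consists of a compact metric space $(X,d)$ with at least two points and a continuous map $f:X\to X$; $h_{top}(f)$ is topological entropy. For $x\in X$, $\omega(x,f)$ is the $\omega$-limit set of $x$; $\mathrm{Trans}(f)=\{x:\omega(x,f)=X\}$ and $\mathrm{Rec}(f)=\{x:x\in\omega(x,f)\}$. Non-uniform specification: $(X,f)$ has the non-uniform specification property with gap function $M:\mathbb{N}\times(0,\infty)\to\mathbb{N}$ ($\mathbb{N}$ the positive integers) if $M(n,\varepsilon)$ is non-decreasing in $n$ and non-increasing in $\varepsilon$, and for every $\varepsilon>0$, every integer $k\ge2$, all $x_1,\dots,x_k\in X$ and all non-negative integers $a_1\le b_1<a_2\le b_2<\cdots<a_k\le b_k$ with $a_{i+1}-b_i\ge M(b_i-a_i+1,\varepsilon)$ for $1\le i\le k-1$, there is $z\in X$ with $d(f^{n-a_i}x_i,f^nz)\le\varepsilon$ for all $a_i\le n\le b_i$, $1\le i\le k$. Let $\mathscr{G}(X,f)$ be the set of all such gap functions for $(X,f)$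 and $\tau(M)=\sup_{\varepsilon>0}\liminf_{n\to\infty}M(n,\varepsilon)/n\in[0,\infty]$. $(X,f)$ has the non-uniform $\tau$-specification property if there is $M\in\mathscr{G}(X,f)$ with $\tau(M)=\tau$ and every $M'\in\mathscr{G}(X,f)$ satisfies $\tau(M')\ge\tau$. Bowen topological entropy of $F\subset X$: let $B_n(x,\varepsilon)=\{y:\max_{0\le i\le n-1}d(f^ix,f^iy)<\varepsilon\}$. For $t\ge0$ let $C(F;t,N,\varepsilon,f)$ be the infimum of $\sum_k e^{-tn_k}$ over finite or countable covers $\{B_{n_k}(x_k,\varepsilon)\}$ of $F$ with $x_k\in F$, $n_k\ge N$; let $C(F;t,\varepsilon,f)=\lim_{N\to\infty}C(F;t,N,\varepsilon,f)$, $h_{top}^B(F;\varepsilon,f)=\inf\{t\ge0:C(F;t,\varepsilon,f)=0\}$ and $h_{top}^B(f,F)=\lim_{\varepsilon\to0}h_{top}^B(F;\varepsilon,f)$. *)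

(* Defs.v *)
From HB Require Import structures.
From mathcomp Require Import all_boot all_order all_algebra.
From mathcomp Require Import all_classical all_reals all_analysis.

Set Implicit Arguments.
Unset Strict Implicit.
Unset Printing Implicit Defensive.

Import Order.TTheory GRing.Theory Num.Theory.
Import numFieldNormedType.Exports.

Local Open Scope classical_set_scope.
Local Open Scope ring_scope.

Definition topological_dynamical_system (R : realType) (X : metricType R)
    (f : X -> X) : Prop :=
  [/\ compact [set: X], continuous f & exists x y : X, x <> y].

Definition omega_limit (R : realType) (X : metricType R) (f : X -> X) (x : X) :
    set X :=
  cluster (iter n f x @[n --> \oo]).

Definition Trans (R : realType) (X : metricType R) (f : X -> X) : set X :=
  [set x | omega_limit f x = [set: X]].

Definition Rec (R : realType) (X : metricType R) (f : X -> X) : set X :=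
  [set x | omega_limit f x x].

(* The Bowen metric; for n = 0 it is identically 0, a value that never
   matters below since n tends to infinity. *)
Definition bowen_dist (R : realType) (X : metricType R) (f : X -> X) (n : nat)
    (x y : X) : R :=
  \big[Order.max/0]_(i < n) mdist (iter i f x) (iter i f y).

Definition bowen_ball (R : realType) (X : metricType R) (f : X -> X) (n : nat)
    (x : X) (e : R) : set X :=
  [set y | bowen_dist f n x y < e].

(* s is a duplicate-free enumeration of an (n, e)-separated finite set. *)
Definition bowen_separated (R : realType) (X : metricType R) (f : X -> X) (n : nat)
    (e : R) (s : seq X) : Prop :=
  uniq s /\
  forall x y, x \in s -> y \in s -> x <> y -> e < bowen_dist f n x y.

Definition separated_number (R : realType) (X : metricType R) (f : X -> X)
    (n : nat) (e : R) : \bar R :=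
  ereal_sup [set (size s)%:R%:E | s in bowen_separated f n e].

Definition h_top (R : realType) (X : metricType R) (f : X -> X) : \bar R :=
  lim (limn_esup (fun n => (n%:R^-1)%:E * lne (separated_number f n e))%E
       @[e --> 0^'+]).

(* Finite or countable covers are families indexed by an arbitrary set K of
   natural numbers. *)
Definition bowen_cover (R : realType) (X : metricType R) (f : X -> X)
    (F : set X) (N : nat) (e : R)
    (K : set nat) (x : nat -> X) (n : nat -> nat) : Prop :=
  (forall k, K k -> F (x k) /\ (N <= n k)%N) /\
  F `<=` \bigcup_(k in K) bowen_ball f (n k) (x k) e.

Definition bowen_C_N (R : realType) (X : metricType R) (f : X -> X)
    (F : set X) (t : R) (N : nat) (e : R) : \bar R :=
  ereal_inf [set v | exists (K : set nat) (x : nat -> X) (n : nat -> nat),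
    bowen_cover f F N e K x n /\
    v = (\esum_(k in K) (expR (- t * (n k)%:R))%:E)%E].

Definition bowen_C (R : realType) (X : metricType R) (f : X -> X)
    (F : set X) (t e : R) : \bar R :=
  limn (fun N => bowen_C_N f F t N e).

Definition h_top_B_at (R : realType) (X : metricType R) (f : X -> X)
    (F : set X) (e : R) : \bar R :=
  ereal_inf [set t%:E | t in [set t : R | 0 <= t /\ bowen_C f F t e = 0%E]].

Definition h_top_B (R : realType) (X : metricType R) (f : X -> X)
    (F : set X) : \bar R :=
  lim (h_top_B_at f F e @[e --> 0^'+]).

(* Gap functions are defined on positive integers and positive reals; M is
   totalized, and its values elsewhere are unconstrained and unused. *)
Definition gap_function (R : realType) (X : metricType R) (f : X -> X)
    (M : nat -> R -> nat) : Prop :=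
  [/\ forall n e, (0 < n)%N -> 0 < e -> (0 < M n e)%N,
      forall m n e, (0 < m)%N -> (m <= n)%N -> 0 < e -> (M m e <= M n e)%N,
      forall n e1 e2, (0 < n)%N -> 0 < e1 -> e1 <= e2 -> (M n e2 <= M n e1)%N
    & forall (e : R) (k : nat) (x : 'I_k -> X) (a b : 'I_k -> nat),
        0 < e -> (2 <= k)%N ->
        (forall i, (a i <= b i)%N) ->
        (forall i j : 'I_k, j = i.+1 :> nat ->
           (b i < a j)%N /\ (M (b i - a i).+1 e <= a j - b i)%N) ->
        exists z : X, forall (i : 'I_k) (n : nat), (a i <= n <= b i)%N ->
          mdist (iter (n - a i) f (x i)) (iter n f z) <= e].

Definition gap_rate (R : realType) (M : nat -> R -> nat) : \bar R :=
  ereal_sup [set limn_einf (fun n => ((M n e)%:R / n%:R)%:E)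
            | e in [set e : R | 0 < e]].

Definition nonuniform_specification (R : realType) (X : metricType R)
    (f : X -> X) (tau : \bar R) : Prop :=
  (exists2 M, gap_function f M & gap_rate M = tau) /\
  (forall M', gap_function f M' -> (tau <= gap_rate M')%E).

(* Main.v *)
(* The system is the one-sided subshift of the sequences over {0, ..., m} in which
   every run of n nonzero letters followed by a 0 is followed by at least g n
   zeros, with g n / n tending to tau. Gluing orbit segments takes gaps of about
   g n, and cannot be done with less: a 0 followed by a nonzero letter comes at
   least g n steps after n nonzero letters. All sequences of nonzero letters are allowed, so
   the entropy is at least ln m, and sparse self-copying makes such sequences
   recurrent at an arbitrarily small cost in entropy (a Kraft inequality bounds
   the Bowen entropy from below). A transitive point contains infinitely many
   zeros, so infinitely many of its prefixes have a proportion of nonzero letters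
   at most theta, where theta = 1/(1+tau), or is arbitrarily small if tau is
   infinite. There are at most 2^N m^(theta N) such prefixes of length N, and the
   factor 2^N is negligible for large m. *)
From HB Require Import structures.
Require Import Defs.
From mathcomp Require Import all_boot all_order all_algebra.
From mathcomp Require Import all_classical all_reals all_analysis.
From mathcomp Require Import zify lra.

Set Implicit Arguments.
Unset Strict Implicit.
Unset Printing Implicit Defensive.

Import Order.TTheory GRing.Theory Num.Theory.
Import numFieldNormedType.Exports.

Local Open Scope classical_set_scope.
Local Open Scope ring_scope.

(** * The gap shift *)

Definition gap_admissible (m : nat) (g : nat -> nat) (x : nat -> 'I_m.+1) :=
  forall i n, (forall j, (j < n)%N -> x (i + j)%N != ord0) ->
    x (i + n)%N = ord0 -> forall j, (j < g n)%N -> x (i + n + j)%N = ord0.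

(* The parameter [R] is a phantom: it lets the metric structure over [R] be
   inferred from the carrier. *)
Record gap_shift (R : realType) (m : nat) (g : nat -> nat) := GapShift {
  gap_seq :> nat -> 'I_m.+1;
  gap_seqP : gap_admissible g gap_seq }.

HB.instance Definition _ R m g := gen_eqMixin (gap_shift R m g).
HB.instance Definition _ R m g := gen_choiceMixin (gap_shift R m g).

Section gap_shift_metric.
Variables (R : realType) (m : nat) (g : nat -> nat).
Local Notation X := (gap_shift R m g).

Lemma gap_seq_inj (x y : X) : x =1 y -> x = y.
Proof.
case: x y => [x Px] [y Py] /= /funext xy; case: _ / xy Py => Py.
by congr GapShift; exact: Prop_irrelevance.
Qed.

Definition seq_dist (x y : X) : R :=
  if pselect (exists i, x i != y i) is left h then (ex_minn h).+1%:R^-1 else 0.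

Lemma seq_dist_ltP (x y : X) n : (seq_dist x y < n.+1%:R^-1) <->
  (forall i, (i <= n)%N -> x i = y i).
Proof.
rewrite /seq_dist; case: pselect => [h|h].
  case: ex_minnP => k xyk kmin.
  rewrite ltf_pV2 ?posrE ?ltr0n// ltr_nat; split=> [nk i ni|xy].
    by apply: contraTeq nk => xyi; have := kmin i xyi; lia.
  by rewrite ltnS ltnNge; apply/negP => kn; have eqk := xy k kn; rewrite eqk eqxx in xyk.
split=> [_ i _|_]; last by rewrite invr_gt0 ltr0n.
by have [//|xyi] := eqVneq (x i) (y i); exfalso; apply: h; exists i.
Qed.

Lemma seq_dist_ge0 (x y : X) : 0 <= seq_dist x y.
Proof. by rewrite /seq_dist; case: pselect => // h; rewrite invr_ge0. Qed.

Lemma seq_distxx (x : X) : seq_dist x x = 0.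
Proof.
by rewrite /seq_dist; case: pselect => // h; have [i] := h; rewrite eqxx.
Qed.

Lemma seq_dist_eq0 (x y : X) : seq_dist x y = 0 -> x = y.
Proof.
move=> xy0; apply: gap_seq_inj => i.
by have /seq_dist_ltP -> // : seq_dist x y < i.+1%:R^-1;
  rewrite xy0 invr_gt0 ltr0n.
Qed.

Lemma seq_dist_sym (x y : X) : seq_dist x y = seq_dist y x.
Proof.
rewrite /seq_dist; case: pselect => [h|h]; case: pselect => [k|k] //.
- congr (_.+1%:R^-1); apply: eq_ex_minn => i; by rewrite eq_sym.
- by exfalso; apply: k; have [i] := h; rewrite eq_sym; exists i.
- by exfalso; apply: h; have [i] := k; rewrite eq_sym; exists i.
Qed.

Lemma seq_dist_triangle (y x z : X) :
  seq_dist x z <= seq_dist x y + seq_dist y z.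
Proof.
rewrite {1}/seq_dist; case: pselect => [h|h]; last first.
  by rewrite addr_ge0 ?seq_dist_ge0.
case: ex_minnP => k xzk _; rewrite leNgt; apply/negP => lt_k.
move/eqP: xzk; apply.
have /seq_dist_ltP -> // : seq_dist x y < k.+1%:R^-1.
  by rewrite (le_lt_trans _ lt_k)// lerDl seq_dist_ge0.
have /seq_dist_ltP -> // : seq_dist y z < k.+1%:R^-1.
by rewrite (le_lt_trans _ lt_k)// lerDr seq_dist_ge0.
Qed.

HB.instance Definition _ := isMetric.Build R X
  seq_distxx seq_dist_eq0 seq_dist_sym seq_dist_triangle.

Lemma mdist_gap_ltP (x y : X) n : (mdist x y < n.+1%:R^-1) <->
  (forall i, (i <= n)%N -> x i = y i).
Proof. exact: seq_dist_ltP. Qed.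

Lemma mdist_gap_lt1 (x y : X) : (mdist x y < 1) <-> x 0%N = y 0%N.
Proof.
rewrite -[X in _ < X](invr1 R) (mdist_gap_ltP x y 0); split => [->//|xy0 i].
by rewrite leqn0 => /eqP ->.
Qed.

(** The resolution of [e]: agreement on the letters of index at most [scale e] gives distance less
    than [e]. *)
Definition scale (e : R) : nat := Num.truncn e^-1.

Lemma invr_scale (e : R) : 0 < e -> (scale e).+1%:R^-1 < e.
Proof.
move=> e0; rewrite -[X in _ < X]invrK ltf_pV2 ?posrE ?invr_gt0 ?ltr0n//.
exact: truncnS_gt.
Qed.

Lemma le_scale (e1 e2 : R) : 0 < e1 -> e1 <= e2 -> (scale e2 <= scale e1)%N.
Proof.
move=> e10 e12; apply: le_truncn.
by rewrite lef_pV2 ?posrE// (lt_le_trans e10).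
Qed.

Lemma mdist_scale (x y : X) (e : R) : 0 < e ->
  (forall i, (i <= scale e)%N -> x i = y i) -> mdist x y < e.
Proof. by move=> e0 /mdist_gap_ltP/lt_trans; apply; exact: invr_scale. Qed.

Lemma nbhs_gap (x : X) (B : set X) : nbhs x B ->
  exists n, forall y : X, (forall i, (i <= n)%N -> x i = y i) -> B y.
Proof.
move=> /nbhs_ballP[e /= e0 eB]; exists (scale e) => y xy; apply: eB.
by rewrite ballEmdist /=; exact: mdist_scale.
Qed.

Lemma nbhs_cylinder (x : X) n :
  nbhs x [set y : X | forall i, (i <= n)%N -> x i = y i].
Proof.
apply/nbhs_ballP; exists n.+1%:R^-1 => /=; first by rewrite invr_gt0.
by move=> y; rewrite ballEmdist => /= /mdist_gap_ltP.
Qed.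

(** An ultrafilter selects one letter at each coordinate, and its limit is the sequence of these
    letters. The limit is admissible because each instance of the condition involves finitely many
    coordinates, on which the limit agrees with some point of the shift. *)
Lemma gap_shift_compact : compact [set: X].
Proof.
rewrite compact_ultra => F UF _.
have ex_letter i : exists a, F [set x : X | x i = a].
  apply: contrapT => /forallNP noa.
  (* If no letter were selected, avoiding all letters at once would be a large set, yet it is
     empty. *)
  have avoid (s : seq 'I_m.+1) : F [set x : X | x i \notin s].
    elim: s => [|a s IHs]; first by apply: filterS filterT.
    have : F (~` [set x : X | x i = a]).
      by case: (in_ultra_setVsetC [set x : X | x i = a] UF) => [/noa|].
    by apply: filterS2 IHs => x /= xs /eqP xa; rewrite inE negb_or xa.
  by have [x /=] := filter_ex (avoid (enum 'I_m.+1)); rewrite mem_enum.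
have [a Fa] := choice ex_letter.
have Fcyl n : F [set x : X | forall i, (i <= n)%N -> x i = a i].
  elim: n => [|n IHn]; first by apply: filterS (Fa 0%N) => x xa i; rewrite leqn0 => /eqP ->.
  apply: filterS2 IHn (Fa n.+1) => x xa xan i.
  by rewrite leq_eqVlt => /predU1P[->//|]; exact: xa.
have aP : gap_admissible g a.
  move=> i n an an0 j jgn.
  have [x xa] := filter_ex (Fcyl (i + n + j)%N).
  rewrite -xa//; apply: (@gap_seqP _ _ _ x i n _ _ j jgn) => [k kn|]; rewrite xa//; try lia.
  exact: an.
exists (GapShift R aP); split => //= B /nbhs_gap[n nB].
by apply: filterS (Fcyl n) => x xa; apply: nB => i /xa.
Qed.

Lemma gap_admissible_left_shift (x : X) : gap_admissible g (fun n => x n.+1).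
Proof.
by move=> i n xn xn0 j; apply: (@gap_seqP _ _ _ x i.+1) => // k; exact: xn.
Qed.

Definition left_shift (x : X) : X := GapShift R (@gap_admissible_left_shift x).

Lemma iter_left_shift n (x : X) i : iter n left_shift x i = x (n + i)%N.
Proof. by elim: n i => [//|n IHn] i /=; rewrite IHn addnS. Qed.

Lemma left_shift_continuous : continuous left_shift.
Proof.
move=> x B /nbhs_gap[n nB]; apply: filterS (nbhs_cylinder x n.+1) => y xy.
by apply: nB => i ni /=; apply: xy.
Qed.

Lemma bowen_dist_lt (x y : X) n (e : R) : 0 < e ->
  (forall i, (i < n + scale e)%N -> x i = y i) -> bowen_dist left_shift n x y < e.
Proof.
move=> e0 xy; apply/bigmax_ltP; split => // i _.
apply: mdist_scale => // j jK; rewrite !iter_left_shift; apply: xy.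
by have := ltn_ord i; lia.
Qed.

Lemma bowen_dist_lt1 (x y : X) n (i : nat) :
  bowen_dist left_shift n x y < 1 -> (i < n)%N -> x i = y i.
Proof.
move=> /bigmax_ltP[_ xy] ltin; have := xy (Ordinal ltin) isT.
by move=> /mdist_gap_lt1; rewrite !iter_left_shift addn0.
Qed.

End gap_shift_metric.

(** * Specification *)

Section gap_shift_specification.
Variables (R : realType) (m : nat) (g : nat -> nat).
Hypotheses (g0 : g 0%N = 1%N) (g_nd : {homo g : i j / (i <= j)%N}).
Local Notation X := (gap_shift R m g).

(** The word of [x i] is copied on [[a i, b i + scale e]] and zeros are put elsewhere. A run of
    nonzero letters stays within one copy, of length [L i], and at least [g (L i)] zeros separate
    this copy from the next. *)
Lemma gap_specification :
  gap_function (@left_shift R m g) (fun n e => (scale e).+1 + g (n + scale e))%N.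
Proof.
split=> [//|n1 n2 e _ n12 _|n e1 e2 _ e10 e12|e k x a b e0 k2 ab abM].
- by rewrite leq_add2l g_nd// leq_add2r.
- by apply: leq_add; [|apply: g_nd; rewrite leq_add2l]; rewrite ?ltnS le_scale.
set K := scale e in abM *; pose L i := ((b i - a i).+1 + K)%N.
have step (i j : 'I_k) : j = i.+1 :> nat -> (b i + K + g (L i) < a j)%N.
  by move=> /abM[? ?]; rewrite /L; lia.
have lt_a (i j : 'I_k) : (i < j)%N -> (b i + K + g (L i) < a j)%N.
  case: j => j jk /=; elim: j jk => [//|j IHj] jk.
  rewrite ltnS leq_eqVlt => /predU1P[ij|ij]; first by apply: step; rewrite /= ij.
  have jk' : (j < k)%N by lia.
  have := IHj jk' ij; have := step (Ordinal jk') (Ordinal jk) erefl.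
  by have := ab (Ordinal jk'); lia.
pose z n := if [pick i | a i <= n <= b i + K]%N is Some i
  then x i (n - a i)%N else ord0.
have zE i n : (a i <= n <= b i + K)%N -> z n = x i (n - a i)%N.
  move=> ain; rewrite /z; case: pickP => [j jn|/(_ i)]; last by rewrite ain.
  have [ij|ji|/val_inj ->//] := ltngtP i j.
    by have := lt_a _ _ ij; lia.
  by have := lt_a _ _ ji; lia.
have z0 i n : (b i + K < n <= b i + K + g (L i))%N -> z n = ord0.
  move=> bin; rewrite /z; case: pickP => [j jn|//].
  have := ab i; have [ij|ji|/val_inj ij] := ltngtP i j.
  - by have := lt_a _ _ ij; lia.
  - by have := lt_a _ _ ji; lia.
  - by rewrite -ij in jn; lia.
have zP : gap_admissible g z.
  (* The empty run asks for [g 0 = 1] zero, which is the given one. *)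
  move=> s [|n] zn zn0 j jg.
    by move: jg zn0; rewrite g0 ltnS leqn0 => /eqP ->; rewrite !addn0.
  have [i iz] : exists i, (a i <= s + n <= b i + K)%N.
    have := zn n (ltnSn n); rewrite /z.
    by case: pickP => [i|_]; [exists i | rewrite eqxx].
  (* The run cannot begin before the copy of [x i], which is preceded by a filler zero. *)
  have ais : (a i <= s)%N.
    rewrite leqNgt; apply/negP => sai.
    have := zn ((a i).-1 - s)%N ltac:(lia); rewrite /z.
    case: pickP => [l lz _|_]; last by rewrite eqxx.
    have := ab i; have := ab l; have [il|li|/val_inj il] := ltngtP i l.
    - by have := lt_a _ _ il; lia.
    - have : (0 < g (L l))%N by rewrite -g0 g_nd.
      by have := lt_a _ _ li; lia.
    - by rewrite -il in lz; lia.
  have gL : (g n.+1 <= g (L i))%N by apply: g_nd; rewrite /L; lia.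
  (* Within the copy the zeros come from the admissibility of [x i]; beyond it they are the
     filler. *)
  have [in_i|out_i] := leqP (s + n.+1 + j)%N (b i + K)%N; last first.
    by apply: (z0 i); lia.
  rewrite (zE i); last lia.
  have -> : (s + n.+1 + j - a i = (s - a i) + n.+1 + j)%N by lia.
  apply: (@gap_seqP _ _ _ (x i)) => // [l ln|].
    have := zn l ln; rewrite (zE i); last lia.
    by have -> : (s + l - a i = s - a i + l)%N by lia.
  move: zn0; rewrite (zE i); last lia.
  by have -> : (s + n.+1 - a i = s - a i + n.+1)%N by lia.
exists (GapShift R zP) => i n ain; apply/ltW/mdist_scale => // j jK.
rewrite !iter_left_shift /= (zE i); last lia.
by congr (x i _); lia.
Qed.

Hypothesis m_gt0 : (0 < m)%N.

Definition nonzero_letter : 'I_m.+1 := ord_max.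

Lemma nonzero_letter_neq0 : nonzero_letter != ord0.
Proof. by rewrite -val_eqE /= -lt0n. Qed.

Lemma nonzero_admissible (x : nat -> 'I_m.+1) :
  (forall i, x i != ord0) -> gap_admissible g x.
Proof. by move=> xn0 i n _ /eqP; rewrite (negPf (xn0 _)). Qed.

Definition ones : X := GapShift R (nonzero_admissible (fun=> nonzero_letter_neq0)).

(** The only zero follows an empty run, and [g 0 = 1] requires no further zero. *)
Lemma zero_ones_admissible :
  gap_admissible g (fun i => if i == 0%N then ord0 else nonzero_letter).
Proof.
move=> i n _; case: eqP => [in0 _ j|_ /eqP].
  have -> : n = 0%N by lia.
  by rewrite g0 ltnS leqn0 => /eqP ->; have -> : i = 0%N by lia.
by rewrite (negPf nonzero_letter_neq0).
Qed.

Definition zero_ones : X := GapShift R zero_ones_admissible.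

(* A zero followed by a nonzero letter must be reached after [n] nonzero
   letters, and this takes a run of at least [g n] zeros. *)
Lemma gap_function_ge M n : gap_function (@left_shift R m g) M -> (0 < n)%N ->
  (g n <= M n 2^-1)%N.
Proof.
have e0 : 0 < 2^-1 :> R by rewrite invr_gt0.
move=> [M0 _ _ MP] n0; set l := M n 2^-1; have l0 : (0 < l)%N by exact: M0.
(* The gap is the smallest one allowed, [l]: first [n] nonzero letters, then a zero at [n.-1 + l]
   and a nonzero letter at [n + l]. A radius below 1 forces [z] to have exactly these letters. *)
pose x (i : 'I_2) := if i == ord0 then ones else zero_ones.
pose a (i : 'I_2) := (if i == ord0 then 0 else n.-1 + l)%N.
pose b (i : 'I_2) := (if i == ord0 then n.-1 else n + l)%N.
have ab i : (a i <= b i)%N by rewrite /a /b; case: ifP; lia.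
have abM (i j : 'I_2) : j = i.+1 :> nat ->
    (b i < a j)%N /\ (M (b i - a i).+1 2^-1 <= a j - b i)%N.
  rewrite /a /b -!val_eqE /= => ji.
  have [-> ->] : (i : nat) = 0%N /\ (j : nat) = 1%N by have := ltn_ord j; lia.
  by rewrite /= subn0 prednK//; split; rewrite -/l; lia.
have [z zP] := MP _ _ x _ _ e0 isT ab abM.
have {}zP i j : (a i <= j <= b i)%N -> z j = x i (j - a i)%N.
  move=> /zP jP.
  have /mdist_gap_lt1 : mdist (iter (j - a i) (@left_shift R m g) (x i))
      (iter j (@left_shift R m g) z) < 1.
    by apply: le_lt_trans jP _; rewrite invf_lt1// ltr1n.
  by rewrite !iter_left_shift !addn0.
have z1 j : (j < n)%N -> z j != ord0.
  by move=> jn; rewrite (zP ord0) ?nonzero_letter_neq0// /a /b /=; lia.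
have z2 : z (n.-1 + l)%N = ord0.
  by rewrite (zP ord_max) /a /b /= ?subnn//; lia.
have z3 : z (n + l)%N != ord0.
  rewrite (zP ord_max) /a /b /=; last lia.
  by have -> : (n + l - (n.-1 + l) = 1)%N; [lia | exact: nonzero_letter_neq0].
(* The first zero [q] of [z] ends a run of [q >= n] nonzero letters; if [l < g n], the [g q] zeros
   from [q] on would reach position [n + l]. *)
have ex0 : exists q, z q == ord0 by exists (n.-1 + l)%N; rewrite z2.
have [q /eqP zq qmin] := ex_minnP ex0.
have nq : (n <= q)%N by rewrite leqNgt; apply/negP => /z1; rewrite zq eqxx.
have ql : (q <= n.-1 + l)%N by apply: qmin; rewrite z2.
rewrite leqNgt; apply/negP => lg.
have gq : (g n <= g q)%N by exact: g_nd.
move/eqP: z3; apply.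
have -> : (n + l = 0 + q + (n + l - q))%N by lia.
apply: (@gap_seqP _ _ _ z 0 q); rewrite ?add0n//; last lia.
by move=> j jq; rewrite add0n; apply: contraTneq jq => zj; rewrite -leqNgt qmin ?zj.
Qed.

End gap_shift_specification.

(** * Topological entropy *)

Section limit_bounds.
Variable R : realType.
Implicit Types (u : (\bar R)^nat) (l : \bar R).
Local Open Scope ereal_scope.

Lemma limn_esup_le_near u l :
  (\forall n \near \oo, u n <= l) -> limn_esup u <= l.
Proof.
move=> ul; apply: ereal_inf_le; exists (ereal_sup (u @` [set n | u n <= l])).
  by exists [set n | u n <= l].
by apply: ge_ereal_sup => _ [n /= nl <-].
Qed.

Lemma limn_esup_ge_near u l :
  (\forall n \near \oo, l <= u n) -> l <= limn_esup u.
Proof.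
move=> lu; apply: le_ereal_inf_tmp => _ [V Voo <-].
have [n [ln Vn]] := filter_ex (filterI lu Voo).
by apply: (le_trans ln); apply: ereal_sup_ubound; exists n.
Qed.

Lemma limn_einf_ge_near u l :
  (\forall n \near \oo, l <= u n) -> l <= limn_einf u.
Proof.
move=> lu; rewrite /limn_einf leeNr; apply: limn_esup_le_near.
by apply: filterS lu => n; rewrite leeN2.
Qed.

Lemma le_limn_esup u v : (forall n, u n <= v n) -> limn_esup u <= limn_esup v.
Proof.
move=> uv; apply: le_ereal_inf_tmp => _ [V Voo <-].
apply: ereal_inf_le; exists (ereal_sup (u @` V)); first by exists V.
apply: ge_ereal_sup => _ [n Vn <-]; apply: (le_trans (uv n)).
by apply: ereal_sup_ubound; exists n.
Qed.

Section at_right0.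
Variable F : R -> \bar R.
Hypothesis F_ni : forall e1 e2 : R, (0 < e1)%R -> (e1 <= e2)%R -> F e2 <= F e1.

(** By monotonicity the limit is a supremum over [e]: an upper bound must hold for all [e], a lower
    bound for one. *)
Let cvg_at_right0 : F e @[e --> 0%R^'+] --> ereal_sup (F @` `]0%R, +oo[).
Proof.
apply: (@nonincreasing_at_right_cvge _ F 0%R +oo%O) => // e1 e2.
by rewrite !in_itv/= !andbT => e10 _; exact: F_ni.
Qed.

Lemma lim_at_right0_le l : (forall e : R, (0 < e)%R -> F e <= l) ->
  lim (F e @[e --> 0%R^'+]) <= l.
Proof.
move=> Fl; rewrite (cvg_lim _ cvg_at_right0)//; apply: ge_ereal_sup => _ [e + <-].
by rewrite /= in_itv/= andbT; exact: Fl.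
Qed.

Lemma lim_at_right0_ge l (e : R) : (0 < e)%R -> l <= F e ->
  l <= lim (F e @[e --> 0%R^'+]).
Proof.
move=> e0 lF; rewrite (cvg_lim _ cvg_at_right0)//; apply: (le_trans lF).
by apply: ereal_sup_ubound; exists e => //=; rewrite in_itv/= e0.
Qed.

End at_right0.
End limit_bounds.

Section gap_shift_entropy.
Variables (R : realType) (m : nat) (g : nat -> nat).
Hypothesis m_gt0 : (0 < m)%N.
Local Notation X := (gap_shift R m g).
Local Notation sh := (@left_shift R m g).

(** Points with the same first [n + scale e] letters are not separated, so these letters determine
    the point within [s]. *)
Lemma size_separated_le n (e : R) (s : seq X) : 0 < e ->
  bowen_separated sh n e s -> (size s <= m.+1 ^ (n + scale e))%N.
Proof.
move=> e0 [us sep]; pose w (x : X) := [ffun i : 'I_(n + scale e) => x i].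
have w_inj : {in s &, injective w}.
  move=> x y xs ys wxy; apply: contrapT => /(sep _ _ xs ys); apply/negP.
  rewrite -leNgt ltW//; apply: bowen_dist_lt => // i iK.
  by move/ffunP: wxy => /(_ (Ordinal iK)); rewrite !ffunE.
have uw : uniq (map w s) by rewrite map_inj_in_uniq.
rewrite -(size_map w); move/card_uniqP: uw => <-.
by rewrite (leq_trans (max_card _))// card_ffun !card_ord.
Qed.

(** [lift ord0] identifies ['I_m] with the nonzero letters; the padding is nonzero too, so that
    every such sequence is admissible. *)
Definition extend_word n (w : {ffun 'I_n -> 'I_m}) (i : nat) : 'I_m.+1 :=
  if insub i is Some j then lift ord0 (w j) else nonzero_letter m.

Lemma extend_word_neq0 n (w : {ffun 'I_n -> 'I_m}) i : extend_word w i != ord0.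
Proof.
rewrite /extend_word; case: insub => [j|]; last exact: nonzero_letter_neq0.
by rewrite eq_sym neq_lift.
Qed.

Definition extend_point n (w : {ffun 'I_n -> 'I_m}) : X :=
  GapShift R (nonzero_admissible (g := g) (extend_word_neq0 w)).

Lemma extend_pointE n (w : {ffun 'I_n -> 'I_m}) (i : 'I_n) :
  extend_point w i = lift ord0 (w i).
Proof. by rewrite /= /extend_word valK. Qed.

Lemma extend_point_inj n : injective (@extend_point n).
Proof.
move=> v w vw; apply/ffunP => i; apply: (@lift_inj _ ord0).
by rewrite -!extend_pointE vw.
Qed.

Lemma separated_words n (e : R) : e < 1 ->
  bowen_separated sh n e (map (@extend_point n) (enum {ffun 'I_n -> 'I_m})).
Proof.
move=> e1; split.
  by rewrite map_inj_uniq ?enum_uniq//; exact: extend_point_inj.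
move=> _ _ /mapP[v _ ->] /mapP[w _ ->] vw; rewrite (lt_le_trans e1)// leNgt.
apply/negP => d1; apply: vw; congr extend_point; apply/ffunP => i.
apply: (@lift_inj _ ord0); rewrite -!extend_pointE.
exact: bowen_dist_lt1 d1 (ltn_ord i).
Qed.

Lemma separated_number_le n (e : R) : 0 < e ->
  (separated_number sh n e <= ((m.+1 ^ (n + scale e))%:R)%:E)%E.
Proof.
move=> e0; apply: ge_ereal_sup => _ [s /(size_separated_le e0) + <-].
by rewrite lee_fin ler_nat.
Qed.

Lemma separated_number_ge n (e : R) : e < 1 ->
  (((m ^ n)%:R)%:E <= separated_number sh n e)%E.
Proof.
move=> e1; apply: ereal_sup_ubound.
exists (map (@extend_point n) (enum {ffun 'I_n -> 'I_m})); first exact: separated_words.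
by rewrite size_map -cardE card_ffun !card_ord.
Qed.

Lemma separated_number_ge0 n (e : R) : (0 <= separated_number sh n e)%E.
Proof. by apply: ereal_sup_ubound; exists [::]. Qed.

Definition growth (e : R) : \bar R :=
  limn_esup (fun n => ((n%:R^-1)%:E * lne (separated_number sh n e))%E).

Lemma growth_ni (e1 e2 : R) : 0 < e1 -> e1 <= e2 -> (growth e2 <= growth e1)%E.
Proof.
move=> _ e12; apply: le_limn_esup => n; apply: lee_wpmul2l.
  by rewrite lee_fin invr_ge0.
rewrite lee_lne ?in_itv/= ?separated_number_ge0 ?leey//.
apply: ereal_sup_le => _ [s [us sep] <-]; exists s => //; split=> // x y xs ys xy.
by apply: le_lt_trans e12 _; exact: sep.
Qed.

(** A crude bound, uniform in [e], which serves to show that [h_top] is finite: for [n > scale e]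
    the extra [scale e] letters at most double the exponent. *)
Lemma growth_le (e : R) : 0 < e -> (growth e <= (2 * ln m.+1%:R)%:E)%E.
Proof.
move=> e0; apply: limn_esup_le_near; exists (scale e).+1 => // n /= Kn.
have n0 : (0 < n)%N by exact: leq_trans Kn.
apply: (@le_trans _ _ ((n%:R^-1)%:E * (ln (m.+1 ^ (n + n))%:R)%:E)%E); last first.
  rewrite natrX lnXn ?ltr0n// -[ln _ *+ _]mulr_natl natrD -EFinM lee_fin.
  by rewrite mulrA mulrDr mulVf ?pnatr_eq0 -?lt0n.
rewrite lee_wpmul2l ?lee_fin ?invr_ge0// -lne_EFin ?ltr0n ?expn_gt0//.
rewrite lee_lne ?in_itv/= ?leey ?andbT ?separated_number_ge0//.
apply: le_trans (separated_number_le n e0) _.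
by rewrite lee_fin ler_nat leq_pexp2l// leq_add2l ltnW.
Qed.

Lemma growth_ge (e : R) : e < 1 -> ((ln m%:R)%:E <= growth e)%E.
Proof.
move=> e1; apply: limn_esup_ge_near; exists 1%N => // n /= n0.
have m0 : 0 < m%:R :> R by rewrite ltr0n.
apply: (@le_trans _ _ ((n%:R^-1)%:E * (ln (m ^ n)%:R)%:E)%E).
  rewrite natrX lnXn// -[ln _ *+ _]mulr_natl -EFinM lee_fin.
  by rewrite mulrA mulVf ?mul1r// pnatr_eq0 -lt0n.
rewrite lee_wpmul2l ?lee_fin ?invr_ge0// -lne_EFin ?ltr0n ?expn_gt0 ?m_gt0//.
rewrite lee_lne ?in_itv/= ?leey ?andbT ?separated_number_ge0 ?lee_fin ?ler0n//.
exact: separated_number_ge.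
Qed.

Lemma h_top_ge : ((ln m%:R)%:E <= h_top sh)%E.
Proof.
apply: (lim_at_right0_ge growth_ni (e := 2^-1)); first by rewrite invr_gt0.
by apply: growth_ge; rewrite invf_lt1// ltr1n.
Qed.

Lemma h_top_fin : h_top sh \is a fin_num.
Proof.
rewrite fin_numElt (lt_le_trans (ltNyr _) h_top_ge)/=.
apply: le_lt_trans (ltry (2 * ln m.+1%:R)).
exact: (lim_at_right0_le growth_ni growth_le).
Qed.

End gap_shift_entropy.

(** * Transitive points *)

Section bowen_entropy.
Variables (R : realType) (X : metricType R) (f : X -> X) (F : set X).
Local Open Scope ereal_scope.

Lemma bowen_C_N_ge0 t N e : 0 <= bowen_C_N f F t N e.
Proof.
apply: le_ereal_inf_tmp => _ [K [x [n [_ ->]]]]; apply: esum_ge0 => k _.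
by rewrite lee_fin expR_ge0.
Qed.

Lemma bowen_C_N_nd t e : nondecreasing_seq (fun N => bowen_C_N f F t N e).
Proof.
move=> N1 N2 N12; apply: ereal_inf_le_tmp => v [K [x [n [[Fx cov] vE]]]].
exists K, x, n; split=> //; split=> // k /Fx[Fxk Nk].
by split=> //; exact: leq_trans N12 Nk.
Qed.

Lemma bowen_C_sup t e :
  bowen_C f F t e = ereal_sup (range (fun N => bowen_C_N f F t N e)).
Proof.
by apply: cvg_lim => //; apply: ereal_nondecreasing_cvgn; exact: bowen_C_N_nd.
Qed.

Lemma bowen_C_eq0 t e : bowen_C f F t e = 0 <->
  (forall N, bowen_C_N f F t N e <= 0).
Proof.
rewrite bowen_C_sup; split=> [C0 N|C0].
  by rewrite -C0; apply: ereal_sup_ubound; exists N.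
apply/eqP; rewrite eq_le; apply/andP; split.
  by apply: ge_ereal_sup => _ [N _ <-]; exact: C0.
by apply: (le_trans (bowen_C_N_ge0 t 0 e)); apply: ereal_sup_ubound; exists 0%N.
Qed.

Lemma h_top_B_at_ni e1 e2 : (0 < e1)%R -> (e1 <= e2)%R ->
  h_top_B_at f F e2 <= h_top_B_at f F e1.
Proof.
move=> _ e12; apply: ereal_inf_le_tmp => _ [t [t0 /bowen_C_eq0 Ct] <-].
exists t => //; split=> //; apply/bowen_C_eq0 => N; apply: le_trans (Ct N).
apply: ereal_inf_le_tmp => v [K [x [n [[Fx cov] vE]]]].
exists K, x, n; split=> //; split=> // y /cov[k Kk yk]; exists k => //.
exact: lt_le_trans yk e12.
Qed.

Lemma h_top_B_le t : (0 <= t)%R ->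
  (forall N (e : R), (0 < e)%R -> bowen_C_N f F t N e <= 0) -> h_top_B f F <= t%:E.
Proof.
move=> t0 Ct; apply: (lim_at_right0_le h_top_B_at_ni) => e e0.
by apply: ereal_inf_lbound; exists t => //; split=> //; apply/bowen_C_eq0 => N; exact: Ct.
Qed.

(** [N = 0] suffices because [bowen_C_N] is nondecreasing in [N], and one radius suffices because
    the limit in [e] is a supremum. *)
Lemma h_top_B_ge s (e : R) : (0 < e)%R ->
  (forall t, (0 <= t)%R -> (t < s)%R -> 0 < bowen_C_N f F t 0 e) ->
  s%:E <= h_top_B f F.
Proof.
move=> e0 Ct; apply: (lim_at_right0_ge h_top_B_at_ni e0).
apply: le_ereal_inf_tmp => _ [t [t0 /bowen_C_eq0 /(_ 0%N) Ct0] <-].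
by rewrite lee_fin leNgt; apply/negP => /(Ct _ t0); rewrite ltNge Ct0.
Qed.

End bowen_entropy.

Section transitive_points.
Variables (R : realType) (m : nat) (g : nat -> nat).
Hypotheses (g0 : g 0%N = 1%N) (m_gt0 : (0 < m)%N).
Local Notation X := (gap_shift R m g).
Local Notation sh := (@left_shift R m g).

Lemma Trans_visit (x y : X) N n : Trans sh x ->
  exists2 l, (N <= l)%N & forall i, (i <= n)%N -> x (l + i)%N = y i.
Proof.
move=> xT; have : omega_limit sh x y by rewrite xT.
move=> /(_ [set iter l sh x | l in [set l | N <= l]%N] _ _ (nbhs_cylinder y n)) [].
  by exists N => // l /= Nl; exists l.
move=> _ [[l /= Nl <-] yl]; exists l => // i ni.
by rewrite -iter_left_shift yl.
Qed.

Definition nonzeros (x : nat -> 'I_m.+1) N : nat :=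
  \sum_(0 <= i < N) (x i != ord0).

Variable sigma : R.
Hypothesis le_g : forall n, sigma * n%:R <= (g n)%:R.

(* Each nonzero run of length [n] before [N] is followed, still before [N], by
   [g n >= sigma * n] zeros. *)
Lemma nonzeros_le (x : nat -> 'I_m.+1) N : gap_admissible g x ->
  (N = 0%N \/ x N.-1 = ord0) -> x N != ord0 ->
  (1 + sigma) * (nonzeros x N)%:R <= N%:R.
Proof.
move=> xP; have [n] := ubnP N; elim: n N => // n IHn N Nn [->|xN0] xN.
  by rewrite /nonzeros big_geq// mulr0.
have [|nex] := pselect (exists p, (p < N)%N && (x p != ord0)); last first.
  rewrite /nonzeros big_nat big1 ?mulr0// => i /andP[_ iN].
  by case: eqP => // /eqP xi; exfalso; apply: nex; exists i; rewrite iN.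
move=> exp; have bnd p : (p < N)%N && (x p != ord0) -> (p <= N)%N by lia.
(* [p] is the last nonzero position before [N] and [s] the start of its run. The induction
   hypothesis is applied to the prefix of length [s]. *)
have [p /andP[pN xp] pmax] := ex_maxnP exp bnd.
have exs : exists s, (s <= p)%N && all (fun i => x i != ord0) (iota s (p.+1 - s)).
  by exists p; rewrite leqnn subSnn /= xp.
have [s /andP[sp /allP xs] smin] := ex_minnP exs.
have {}xs i : (s <= i <= p)%N -> x i != ord0.
  by move=> sip; apply: xs; rewrite mem_iota; lia.
have sstart : s = 0%N \/ x s.-1 = ord0.
  case: s sp xs smin => [|s] sp xs smin; [by left|right].
  apply/eqP; apply: contraT => xs0 /=.
  suff : (s.+1 <= s)%N by rewrite ltnn.
  apply: smin; apply/andP; split; first lia.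
  apply/allP => i; rewrite mem_iota => sip.
  have [->//|si] := eqVneq i s; apply: xs; lia.
have pN1 : (p.+1 < N)%N.
  have [//|] := ltnP p.+1 N => Np; have pE : p = N.-1 by lia.
  by rewrite pE xN0 eqxx in xp.
have xp1 : x p.+1 = ord0.
  by apply/eqP; apply: contraT => xp1; have := pmax p.+1; rewrite pN1 xp1 /=; lia.
(* Otherwise the nonzero letter at [N] would lie among the zeros forced by the run from [s] to
   [p]. *)
have gN : (p.+1 + g (p.+1 - s) <= N)%N.
  rewrite leqNgt; apply/negP => gt; move/eqP: xN; apply.
  have -> : (N = s + (p.+1 - s) + (N - p.+1))%N by lia.
  apply: xP; last by lia.
    by move=> j jp; apply: xs; lia.
  by have -> : (s + (p.+1 - s) = p.+1)%N by lia.
have nzE : nonzeros x N = (nonzeros x s + (p.+1 - s))%N.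
  rewrite /nonzeros (@big_cat_nat _ _ _ s)//=; last lia.
  rewrite (@big_cat_nat _ _ _ p.+1 s)//=; try lia.
  congr (_ + _)%N; rewrite [X in (_ + X)%N]big_nat [X in (_ + X)%N]big1 ?addn0.
    rewrite big_nat (eq_bigr (fun=> 1%N)) -?big_nat ?sum_nat_const_nat ?muln1//.
    by move=> i sip; rewrite xs.
  move=> i /andP[pi iN]; case: eqP => // /eqP xi.
  by have := pmax i; rewrite iN xi /=; lia.
have := IHn s ltac:(lia) sstart (xs s ltac:(lia)).
have := le_g (p.+1 - s); move: gN; rewrite -(ler_nat R) natrD nzE natrD.
rewrite natrB; last lia.
by move: (g _)%:R => G; lra.
Qed.

(** A transitive point shows a zero followed by a nonzero letter arbitrarily late; the prefix is cut
    between the two. *)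
Lemma Trans_nonzeros (x : X) N0 : Trans sh x ->
  exists2 N, (N0 <= N)%N & (1 + sigma) * (nonzeros x N)%:R <= N%:R.
Proof.
move=> xT; have [l Nl xl] := Trans_visit (zero_ones R g0 m_gt0) N0 1 xT.
exists l.+1; first lia.
apply: nonzeros_le; first exact: gap_seqP.
  by right; rewrite -[l.+1.-1]addn0 xl.
by have := xl 1%N isT; rewrite addn1 /= => ->; exact: nonzero_letter_neq0.
Qed.

End transitive_points.

(** * Weighted counts of words, and the covers they provide *)

Section word_sums.
Variable R : realType.

Lemma esum_finType (T : finType) (a : T -> \bar R) : (forall i, (0 <= a i)%E) ->
  (\esum_(i in [set: T]) a i = \sum_i a i)%E.
Proof.
move=> a0; rewrite esum_fset; [|exact: finite_finset|by move=> i _; exact: a0].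
rewrite fsbig_finite; last exact: finite_finset.
apply: perm_big; apply: uniq_perm => [||i].
- exact: finmap.fset_uniq.
- exact: index_enum_uniq.
- by rewrite in_fset_set ?mem_index_enum; [rewrite in_setT|exact: finite_finset].
Qed.

Lemma esum_geometric_le (c r : R) n : 0 <= c -> 0 <= r -> r < 1 ->
  (\esum_(N in [set N | (n <= N)%N]) (c * r ^+ N)%:E <= (c * r ^+ n / (1 - r))%:E)%E.
Proof.
move=> c0 r0 r1.
have -> : [set N | (n <= N)%N] = [set (n + j)%N | j in [set: nat]].
  by apply/seteqP; split=> [N /= nN|_ [j _ <-] /=]; [exists (N - n)%N => //; lia|lia].
rewrite esum_image; last by move=> i j _ _ /addnI.
have pos j : (0 <= (c * r ^+ (n + j))%:E)%E.
  by rewrite lee_fin mulr_ge0// exprn_ge0.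
rewrite -nneseries_esumT//; apply: lime_le; first exact: is_cvg_nneseries.
apply: nearW => k; rewrite sumEFin lee_fin.
rewrite (eq_bigr (fun j => geometric (c * r ^+ n) r j)); last first.
  by move=> j _; rewrite /= exprD mulrA.
have := @geometric_seriesE R (c * r ^+ n) r (negbT (lt_eqF r1)).
move=> /(congr1 (fun h => h k)); rewrite /series/= => ->.
apply: ler_wpM2r; first by rewrite invr_ge0 subr_ge0 ltW.
by rewrite ler_piMr ?mulr_ge0 ?exprn_ge0// gerBl exprn_ge0.
Qed.

(** The weight is a product over positions, each contributing 1 for the zero and [expR (- lambda)]
    for each of the [m] other letters. *)
Lemma sum_words_weight (m N : nat) (lambda : R) : 
  \sum_(w : {ffun 'I_N -> 'I_m.+1}) \prod_i expR (- lambda * (w i != ord0)%:R) =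
  (1 + m%:R * expR (- lambda)) ^+ N.
Proof.
rewrite -(bigA_distr_bigA (fun (i : 'I_N) (a : 'I_m.+1) =>
  expR (- lambda * (a != ord0)%:R))).
rewrite prodr_const card_ord big_ord_recl eqxx mulr0 expR0; congr ((_ + _) ^+ _).
rewrite (eq_bigr (fun=> expR (- lambda))) => [|i _].
  by rewrite sumr_const card_ord mulr_natl.
by rewrite eq_sym neq_lift mulr1.
Qed.

End word_sums.

Section sparse_points.
Variables (R : realType) (m : nat) (g : nat -> nat).
Hypothesis m_gt0 : (0 < m)%N.
Local Notation X := (gap_shift R m g).
Local Notation sh := (@left_shift R m g).
Variables (F : set X) (sigma t e : R).
Hypotheses (sigma_ge0 : 0 <= sigma) (e_gt0 : 0 < e).

Let sparse (x : X) N := (1 + sigma) * (nonzeros x N)%:R <= N%:R.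

Hypothesis F_sparse :
  forall x N0, F x -> exists2 N, (N0 <= N)%N & sparse x N.

Let wordsf N : set {ffun 'I_N -> 'I_m.+1} :=
  [set w | exists x : X, [/\ F x, sparse x N & forall i : 'I_N, w i = x i]].
(** Words of all lengths lie in one countable type, so that [pickle] can index a single cover by
    them. *)
Let words N : set (seq 'I_m.+1) :=
  [set codom (w : {ffun 'I_N -> 'I_m.+1}) | w in @wordsf N].

Let size_words N w : words N w -> size w = N.
Proof. by case=> v _ <-; rewrite size_codom card_ord. Qed.

Let lambda : R := ln m%:R.
Let ratio : R := 2 * expR (lambda / (1 + sigma) - t).

(** An exponential Markov bound: a sparse word has at most [N / (1 + sigma)] nonzero letters, so
    [expR (lambda / (1 + sigma) * N) * wt w >= 1]. For [lambda = ln m] the weights of all words of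
    length [N] sum to [2 ^ N]. *)
Let esum_words N : (scale e <= N)%N ->
  (\esum_(w in words N) (expR (- t * (size w - scale e)%:R))%:E <=
   (expR (t * (scale e)%:R) * ratio ^+ N)%:E)%E.
Proof.
move=> KN; rewrite esum_image; last first.
  move=> v w _ _ /(congr1 (nth ord0)) vw; apply/ffunP => i.
  have := congr1 (fun h => h (enum_rank i : nat)) vw.
  by rewrite !nth_codom !enum_rankK.
have s0 : 0 < 1 + sigma by rewrite ltr_wpDr.
have m0 : 0 < m%:R :> R by rewrite ltr0n.
pose c := expR (- t * (N - scale e)%:R + lambda / (1 + sigma) * N%:R).
pose wt (w : {ffun 'I_N -> 'I_m.+1}) := \prod_i expR (- lambda * (w i != ord0)%:R).
have wt0 w : 0 <= wt w by apply: prodr_ge0 => i _; exact: expR_ge0.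
apply: (@le_trans _ _ (\esum_(w in [set: {ffun 'I_N -> 'I_m.+1}]) (c * wt w)%:E)%E).
  rewrite esum_mkcond; apply: le_esum => w _; case: ifPn => [|_]; last first.
    by rewrite lee_fin mulr_ge0 ?expR_ge0.
  rewrite inE => -[x [Fx xN wx]]; rewrite size_codom card_ord lee_fin.
  rewrite /wt -expR_sum -expRD ler_expR -addrA lerDl -mulr_sumr.
  have -> : \sum_(i < N) (w i != ord0)%:R = (nonzeros x N)%:R :> R.
    by rewrite /nonzeros big_mkord natr_sum; apply: eq_bigr => i _; rewrite wx.
  rewrite mulNr subr_ge0 -mulrA ler_wpM2l ?ln_ge0 ?ler1n//.
  by rewrite mulrC ler_pdivlMr// mulrC.
rewrite esum_finType; last by move=> w; rewrite lee_fin mulr_ge0 ?expR_ge0.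
rewrite sumEFin -mulr_sumr sum_words_weight lee_fin.
have -> : 1 + m%:R * expR (- lambda) = 2 :> R.
  by rewrite expRN lnK ?posrE// mulfV ?lt0r_neq0.
rewrite /ratio exprMn -expRM_natr mulrCA mulrC ler_wpM2l ?exprn_ge0//.
rewrite -expRD ler_expR natrB//.
by rewrite mulrBl mulrBr; lra.
Qed.

(** The sparse prefixes of length at least [N1] give a cover of [F], whose weight is bounded by the
    tail of a convergent geometric series. *)
Lemma sparse_bowen_C_N_le0 N0 : ratio < 1 -> (bowen_C_N sh F t N0 e <= 0)%E.
Proof.
move=> ratio1; have ratio0 : 0 <= ratio by rewrite mulr_ge0 ?expR_ge0.
apply/lee_addgt0Pr => eta eta0; rewrite add0e.
have [F0|/set0P[x0 Fx0]] := eqVneq F set0.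
  apply: ereal_inf_le; exists 0%E; last by rewrite lee_fin ltW.
  exists set0, (fun=> ones R g m_gt0), id; split; last by rewrite esum_set0.
  by split=> //; rewrite F0.
(* A prefix of length [N] controls Bowen balls of order [N - scale e] only, and this order has to be
   at least [N0]. *)
have [N1 N01 N1eta] : exists2 N1, (N0 + scale e <= N1)%N &
    expR (t * (scale e)%:R) * ratio ^+ N1 / (1 - ratio) <= eta.
  have : (fun n => expR (t * (scale e)%:R) / (1 - ratio) * ratio ^+ n) @ \oo --> 0.
    rewrite -[X in _ --> X](mulr0 (expR (t * (scale e)%:R) / (1 - ratio))).
    apply: cvgMr; apply: cvg_expr; by rewrite ger0_norm.
  move=> /cvgr_le /(_ eta eta0) [N1 _ N1P].
  exists (maxn N1 (N0 + scale e)); first exact: leq_maxr.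
  by rewrite mulrAC; apply: N1P; rewrite /= leq_maxl.
(* Centres must belong to [F]: each word gets a point of [F] that begins with it, and [x0] is a
   default for the other sequences. *)
have point_of w : exists x : X, (exists N, words N w) ->
    F x /\ forall i, (i < size w)%N -> nth ord0 w i = x i.
  have [[N [v [x [Fx _ vx]] vw]]|h] := pselect (exists N, words N w); last first.
    by exists x0 => /h.
  exists x => _; split=> // i; rewrite -vw size_codom card_ord => iN.
  have -> : i = enum_rank (Ordinal iN) :> nat by rewrite enum_rank_ord.
  by rewrite nth_codom enum_rankK vx enum_rank_ord.
have [pt ptP] := choice point_of.
pose Ws : set (seq 'I_m.+1) := \bigcup_(N in [set N | (N1 <= N)%N]) words N.
pose u k : seq 'I_m.+1 := odflt [::] (unpickle k).
have pickleu w : u (pickle w) = w by rewrite /u pickleK.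
apply: (@le_trans _ _ (\esum_(k in pickle @` Ws)
    (expR (- t * (size (u k) - scale e)%:R))%:E)%E).
  apply: ereal_inf_lbound.
  exists (pickle @` Ws), (fun k => pt (u k)), (fun k => size (u k) - scale e)%N.
  split=> //; split.
    move=> _ [w [N /= NN1 wN] <-]; rewrite pickleu; split.
      by have [] := ptP w (ex_intro _ N wN).
    by rewrite (size_words wN); lia.
  move=> x Fx; have [N NN1 xN] := F_sparse N1 Fx.
  pose v : {ffun 'I_N -> 'I_m.+1} := [ffun i : 'I_N => x i].
  have vN : words N (codom v).
    by exists v => //; exists x; split=> // i; rewrite ffunE.
  exists (pickle (codom v)); first by exists (codom v) => //; exists N.
  rewrite /bowen_ball /= pickleu; apply: bowen_dist_lt => // i.
  rewrite (size_words vN) => iN.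
  have {}iN : (i < N)%N by move: iN; rewrite /= in NN1; lia.
  have [_ <-] := ptP _ (ex_intro _ N vN); last by rewrite (size_words vN).
  have -> : i = enum_rank (Ordinal iN) :> nat by rewrite enum_rank_ord.
  by rewrite nth_codom enum_rankK ffunE enum_rank_ord.
rewrite esum_image; last by move=> v w _ _; exact: (pcan_inj pickleK).
under eq_esum do rewrite pickleu.
rewrite esum_bigcupT; [|apply/trivIsetP|by move=> w; rewrite lee_fin expR_ge0]; last first.
  move=> i j _ _ /eqP ij; apply/seteqP; split=> // w [/size_words wi /size_words wj].
  by apply: ij; rewrite -wi wj.
apply: (@le_trans _ _ (\esum_(N in [set N | (N1 <= N)%N])
    (expR (t * (scale e)%:R) * ratio ^+ N)%:E)%E).
  by apply: le_esum => N /= NN1; apply: esum_words; lia.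
by apply: le_trans (esum_geometric_le _ _ _ _) _.
Qed.

End sparse_points.

(** * Recurrent points *)

(* A Kraft inequality for sequences whose letters at the positions [i] that are
   not [free] are copied from an earlier position [src i]. *)
Section kraft.
Variables (R : realType) (T : finType) (a0 : T).
Variables (free : pred nat) (src : nat -> nat).
Hypothesis src_lt : forall n, ~~ free n -> (src n < n)%N.

Definition nfree n : nat := \sum_(0 <= i < n) free i.

Lemma nfreeS n : nfree n.+1 = (nfree n + free n)%N.
Proof. by rewrite /nfree big_nat_recr. Qed.

Lemma nfree_le i j : (i <= j)%N -> (nfree i <= nfree j)%N.
Proof.
by move=> ij; rewrite /nfree (@big_cat_nat _ _ _ i 0 j)//= leq_addr.
Qed.

Variables (K : set nat) (y : nat -> nat -> T) (len : nat -> nat).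

Let agree (x : nat -> T) j k := [forall i : 'I_j, (i < len k)%N ==> (x i == y k i)].

(* The conditional probability of the cylinder of [y k] of length [len k] given
   the first [j] letters of [x], when the free letters are uniform. *)
Let phi k j (x : nat -> T) : R :=
  if agree x j k then (#|T|%:R ^- (nfree (len k) - nfree j)) else 0.

Let phi_ge0 k j x : 0 <= phi k j x.
Proof. by rewrite /phi; case: ifP => // _; rewrite invr_ge0 exprn_ge0. Qed.

(** A bound for the expected number of cylinders that contain the point, given its first [j]
    letters. At [j = 0] it is at most the Kraft sum. *)
Let Phi j x : \bar R := (\esum_(k in K) (phi k j x)%:E)%E.

Let eq_agree j k (x x' : nat -> T) : (forall i, (i < j)%N -> x i = x' i) ->
  agree x j k = agree x' j k.
Proof. by move=> xx'; apply: eq_forallb => i; rewrite xx'. Qed.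

Let eq_Phi j (x x' : nat -> T) : (forall i, (i < j)%N -> x i = x' i) ->
  Phi j x = Phi j x'.
Proof. by move=> xx'; apply: eq_esum => k _; rewrite /phi (eq_agree _ xx'). Qed.

Let upd (x : nat -> T) j a i := if i == j then a else x i.

Let updE x j a i : (i < j)%N -> upd x j a i = x i.
Proof. by move=> ij; rewrite /upd ltn_eqF. Qed.

Let agreeS x j k : agree x j.+1 k = agree x j k && ((j < len k)%N ==> (x j == y k j)).
Proof.
apply/forallP/andP => [xk|[/forallP xk xj] [i ij] /=].
  split; last exact: (xk ord_max).
  by apply/forallP => i; exact: (xk (widen_ord (leqnSn j) i)).
move: ij; rewrite ltnS leq_eqVlt => /predU1P[->//|ij].
exact: (xk (Ordinal ij)).
Qed.

Let T_gt0 : 0 < #|T|%:R :> R.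
Proof. by rewrite ltr0n; apply/card_gt0P; exists a0. Qed.

Let phi_forced k j x a : ~~ free j -> phi k j.+1 (upd x j a) <= phi k j x.
Proof.
move=> fj; rewrite /phi agreeS (eq_agree _ (@updE x j a)) nfreeS (negPf fj) addn0.
by case: agree => //=; case: ifP => // _; rewrite invr_ge0 exprn_ge0.
Qed.

(** If [j < len k], only the letter [y k j] keeps the agreement, and it multiplies the value by
    [#|T|]; if [len k <= j], the value does not depend on the letter. *)
Let phi_free k j x : free j ->
  \sum_a phi k j.+1 (upd x j a) <= \sum_(a : T) phi k j x.
Proof.
move=> fj; rewrite /phi; under eq_bigr => a _.
  rewrite agreeS (eq_agree _ (@updE x j a)) nfreeS fj addn1 /upd eqxx; over.
case: agree => /=; last by rewrite big1.
have [jk|kj] := ltnP j (len k); last first.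
  apply: ler_sum => a _ /=; have := nfree_le kj => kj'.
  have -> : (nfree (len k) - nfree j = 0)%N by lia.
  by have -> : (nfree (len k) - (nfree j).+1 = 0)%N by lia.
have := nfree_le jk; rewrite nfreeS fj addn1 => jk'.
rewrite /= -big_mkcond /= big_pred1_eq sumr_const.
have -> : (nfree (len k) - nfree j = (nfree (len k) - (nfree j).+1).+1)%N by lia.
by rewrite exprS invfM -[leRHS]mulr_natl mulrA mulfV ?lt0r_neq0// mul1r.
Qed.

(** At a free position some letter does at least as well as the average; at a copied one the imposed
    letter never increases any [phi]. *)
Let step x j : (Phi j x < 1)%E ->
  exists a, (~~ free j -> a = x (src j)) /\ (Phi j.+1 (upd x j a) <= Phi j x)%E.
Proof.
move=> Phi1; case: (boolP (free j)) => [fj|fj]; last first.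
  exists (x (src j)); split=> //; apply: le_esum => k _.
  by rewrite lee_fin phi_forced.
have sumP : (\sum_a Phi j.+1 (upd x j a) <= \sum_(a : T) Phi j x)%E.
  rewrite -!esum_sum; try by move=> *; rewrite lee_fin.
  by apply: le_esum => k _; rewrite !sumEFin lee_fin phi_free.
apply: contrapT => /forallNP noa.
have gt a : (Phi j x < Phi j.+1 (upd x j a))%E.
  by rewrite ltNge; apply/negP => le_a; apply: (noa a); split=> //; rewrite fj.
have Phi0 i z : (0 <= Phi i z)%E by apply: esum_ge0 => k _; rewrite lee_fin.
(* Finiteness lets the strict inequality at [a0] survive the summation. *)
have fin : Phi j x \is a fin_num.
  by rewrite ge0_fin_numE// (lt_trans Phi1)// ltry.
move: sumP; rewrite leNgt => /negP; apply.
rewrite (bigD1 a0)//= [ltRHS](bigD1 a0)//=; apply: lte_leD => //.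
  by apply/sum_fin_numP => a _ _.
by apply: lee_sum => a _; exact: ltW.
Qed.

(** The method of conditional expectations: letters are chosen one by one so that [Phi] stays below
    1, whereas entering the cylinder of [y k] would make the term of [k] equal to 1. *)
Lemma kraft_avoid : (\esum_(k in K) (#|T|%:R ^- nfree (len k))%:E < (1 : \bar R))%E ->
  exists2 x : nat -> T, forall n, ~~ free n -> x n = x (src n) &
    forall k, K k -> exists2 i, (i < len k)%N & x i != y k i.
Proof.
move=> lt1.
have choose z : exists a, (Phi z.2 z.1 < 1)%E ->
    (~~ free z.2 -> a = z.1 (src z.2)) /\ (Phi z.2.+1 (upd z.1 z.2 a) <= Phi z.2 z.1)%E.
  have [/step[a aP]|h] := pselect (Phi z.2 z.1 < 1)%E; first by exists a.
  by exists a0 => /h.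
have [nxt nxtP] := boolp.choice choose.
(* In [u n] the first [n] letters are settled and the others are [a0]; [x] is the diagonal limit. *)
pose u := fix u n := if n is j.+1 then upd (u j) j (nxt (u j, j)) else fun=> a0.
have Phiu n : (Phi n (u n) < 1)%E.
  elim: n => [|n IHn]; last first.
    by apply: (le_lt_trans _ IHn); exact: (nxtP (u n, n) IHn).2.
  apply: le_lt_trans lt1; apply: le_esum => k _; rewrite lee_fin /phi.
  have -> : nfree 0 = 0%N by rewrite /nfree big_geq.
  by case: ifP => _; rewrite ?subn0// invr_ge0 exprn_ge0.
pose x i := u i.+1 i.
have ux n i : (i < n)%N -> u n i = x i.
  elim: n => [//|n IHn]; rewrite ltnS leq_eqVlt => /predU1P[->//|iN].
  by rewrite -IHn//= updE.
exists x => [n fn|k Kk].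
  have [xn _] := nxtP (u n, n) (Phiu n).
  by rewrite /x /= /upd eqxx xn//= ux// src_lt.
apply: contrapT => /forall2NP noi.
have : (1 <= Phi (len k) x)%E.
  apply: (@le_trans _ _ (phi k (len k) x)%:E).
    have -> : phi k (len k) x = 1; last by [].
    rewrite /phi subnn invr1 ifT//; apply/forallP => i; apply/implyP => ik.
    by have [nik|/negP/negPn//] := noi i; case: nik.
  apply: esum_ge; exists [set k]; last by rewrite fsbig_set1.
  by split=> [|_ -> //]; exact: finite_set1.
rewrite (eq_Phi (x' := u (len k))); last by move=> i /ux.
by rewrite leNgt Phiu.
Qed.

End kraft.

Section copied_positions.
Variable Q : nat.
Hypothesis Q_gt0 : (0 < Q)%N.

(** The start of the dyadic block of [n]. At [n = 0] it is 1, hence the guard [0 < n] in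
    [copied]. *)
Definition block_start n := (2 ^ trunc_log 2 n)%N.

(* In each dyadic block [2 ^ k, 2 ^ k.+1), the first [2 ^ k %/ Q] letters
   repeat the beginning of the sequence. *)
Definition copied n := (0 < n)%N && ((n - block_start n).+1 * Q <= block_start n)%N.

Lemma block_start_add k j : (j < 2 ^ k)%N -> block_start (2 ^ k + j) = (2 ^ k)%N.
Proof.
move=> jk; congr (_ ^ _)%N; apply: trunc_log_eq => //.
by rewrite leq_addr expnS mul2n -addnn ltn_add2l.
Qed.

Lemma copied_add k j : (j < 2 ^ k)%N -> copied (2 ^ k + j) = (j.+1 * Q <= 2 ^ k)%N.
Proof.
by move=> jk; rewrite /copied block_start_add// addKn addn_gt0 expn_gt0.
Qed.

(** Complete blocks up to [2 ^ k] contribute at most [2 ^ k] to the left side, and the last, partial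
    block at most [2 ^ k] more; the two together are at most [2 * n]. *)
Lemma copied_count n :
  (Q * (\sum_(0 <= i < n) copied i) <= 2 * n)%N.
Proof.
have block k d : (d <= 2 ^ k)%N -> (\sum_(0 <= i < 2 ^ k + d) copied i <=
    \sum_(0 <= i < 2 ^ k) copied i + minn d (2 ^ k %/ Q))%N.
  elim: d => [|d IHd] dk; first by rewrite addn0 leq_addr.
  rewrite addnS big_nat_recr//= copied_add// -leq_divRL//.
  by have := IHd (ltnW dk); case: leqP => /=; lia.
have dyadic k : (Q * (\sum_(0 <= i < 2 ^ k) copied i) <= 2 ^ k)%N.
  elim: k => [|k IHk]; first by rewrite big_nat1 /copied muln0.
  have := block k _ (leqnn _); rewrite addnn -mul2n -expnS => le_block.
  apply: leq_trans (leq_mul (leqnn Q) le_block) _.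
  rewrite mulnDr expnS mul2n -addnn leq_add//.
  by rewrite mulnC (leq_trans _ (leq_divM (2 ^ k) Q))// leq_mul2r geq_minr orbT.
have [->|n_gt0] := posnP n; first by rewrite big_geq// muln0.
have /andP[kn nk] := trunc_log_bounds (isT : 1 < 2)%N n_gt0.
set k := trunc_log 2 n in kn nk.
have -> : n = (2 ^ k + (n - 2 ^ k))%N by lia.
have := block k (n - 2 ^ k)%N ltac:(rewrite expnS in nk; lia) => le_block.
apply: leq_trans (leq_mul (leqnn Q) le_block) _.
rewrite mulnDr.
apply: (@leq_trans (2 ^ k + 2 ^ k)%N); last by lia.
rewrite leq_add//.
by rewrite mulnC (leq_trans _ (leq_divM (2 ^ k) Q))// leq_mul2r geq_minr orbT.
Qed.

End copied_positions.

Section recurrent_points.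
Variables (R : realType) (m Q : nat) (g : nat -> nat).
Hypotheses (m_gt0 : (0 < m)%N) (Q_gt0 : (0 < Q)%N).
Local Notation X := (gap_shift R m g).
Local Notation sh := (@left_shift R m g).

(** For large [k] the block starting at [2 ^ k] begins with the first [n.+1] letters, so the orbit
    returns at time [2 ^ k]. *)
Lemma Rec_copied (p : X) :
  (forall n, copied Q n -> p n = p (n - block_start n)%N) -> Rec sh p.
Proof.
move=> pP A B [N0 _ AN0] /nbhs_gap[n nB].
pose k := (N0 + n.+1 * Q)%N; have kk : (k < 2 ^ k)%N by exact: ltn_expl.
exists (iter (2 ^ k) sh p); split; first by apply: AN0 => /=; lia.
apply: nB => i ni; rewrite iter_left_shift.
have iQ : (i.+1 * Q <= n.+1 * Q)%N by rewrite leq_mul2r ltnS ni orbT.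
have ik : (i < 2 ^ k)%N.
  by rewrite (leq_trans (leq_pmulr i.+1 Q_gt0))//; lia.
by rewrite [RHS]pP ?block_start_add ?addKn ?copied_add//; lia.
Qed.

Lemma nfree_ge n :
  (1 - 2 / Q%:R) * n%:R <= (nfree (fun i => ~~ copied Q i) n)%:R :> R.
Proof.
have nE : (nfree (fun i => ~~ copied Q i) n + \sum_(0 <= i < n) copied Q i = n)%N.
  rewrite /nfree -big_split /= (eq_bigr (fun=> 1%N)); last first.
    by move=> i _; rewrite addn_negb.
  by rewrite sum_nat_const_nat subn0 muln1.
rewrite mulrBl mul1r lerBlDr -{1}nE natrD lerD2l.
rewrite mulrAC ler_pdivlMr ?ltr0n// mulrC -!natrM ler_nat.
exact: copied_count.
Qed.

(** A cover of weight less than 1 would have a Kraft sum less than 1, since the free positions have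
    density at least [1 - 2 / Q]. The resulting sequence of nonzero letters would be a recurrent
    point outside all the balls. *)
Lemma Rec_bowen_C_N_ge1 t :
  t <= (1 - 2 / Q%:R) * ln m%:R -> (1 <= bowen_C_N sh (Rec sh) t 0 1)%E.
Proof.
move=> tm; apply: le_ereal_inf_tmp => _ [K [x [n [[_ cov] ->]]]].
rewrite leNgt; apply/negP => lt1.
pose a0 : 'I_m := Ordinal m_gt0.
(* A zero of a centre is decoded as [a0]; where a centre agrees with [p] its letter is nonzero, and
   the decoding is faithful. *)
pose y k i : 'I_m := odflt a0 (unlift ord0 (x k i)).
have m0 : 0 < m%:R :> R by rewrite ltr0n.
have [||z zsrc zy] := @kraft_avoid R 'I_m a0 (fun i => ~~ copied Q i)
    (fun i => i - block_start i)%N _ K y n.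
- move=> i; rewrite negbK /copied => /andP[i0 _].
  by have : (0 < block_start i)%N; [rewrite /block_start expn_gt0|lia].
- apply: le_lt_trans lt1; apply: le_esum => k _; rewrite lee_fin card_ord.
  rewrite -[in leLHS](lnK m0) -expRM_natr -expRN ler_expR mulNr lerN2.
  apply: le_trans (ler_wpM2r _ tm) _; first exact: ler0n.
  by rewrite mulrAC mulrC ler_wpM2l ?nfree_ge// ln_ge0// ler1n.
have zn0 i : lift ord0 (z i) != ord0 by rewrite eq_sym neq_lift.
pose p : gap_shift R m g := GapShift R (nonzero_admissible (g := g) zn0).
have pR : Rec (@left_shift R m g) p.
  apply: Rec_copied => i ci; congr lift; apply: zsrc; by rewrite negbK.
have [k Kk pk] := cov _ pR.
have [i ik /eqP] := zy k Kk; apply.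
by rewrite /y (bowen_dist_lt1 pk ik) /= liftK.
Qed.

Lemma h_top_B_Rec_ge :
  (((1 - 2 / Q%:R) * ln m%:R)%:E <= h_top_B sh (Rec sh))%E.
Proof.
apply: (@h_top_B_ge _ _ _ _ _ 1) => // t _ /ltW/Rec_bowen_C_N_ge1.
exact: lt_le_trans.
Qed.

End recurrent_points.

(** * The gap rate, and the choice of the parameters *)

Section gap_rates.
Variables (R : realType) (m : nat) (g : nat -> nat).
Hypotheses (g0 : g 0%N = 1%N) (g_nd : {homo g : i j / (i <= j)%N}).
Local Notation sh := (@left_shift R m g).

Lemma gap_rate_ge (M : nat -> R -> nat) (s : R) : (0 < m)%N ->
  gap_function sh M -> (\forall n \near \oo, s * n%:R <= (g n)%:R) ->
  (s%:E <= gap_rate M)%E.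
Proof.
move=> m_gt0 MP sg.
apply: (@le_trans _ _ (limn_einf (fun n => ((M n 2^-1)%:R / n%:R)%:E))); last first.
  by apply: ereal_sup_ubound; exists 2^-1 => //=; rewrite invr_gt0.
apply: limn_einf_ge_near; near=> n.
have n0 : (0 < n)%N by near: n; exists 1%N.
rewrite lee_fin ler_pdivlMr ?ltr0n//.
have gM := gap_function_ge g0 g_nd m_gt0 MP n0.
by apply: (@le_trans _ _ (g n)%:R); [near: n | rewrite ler_nat].
Unshelve. all: by end_near. Qed.

Lemma gap_rate_le (s : R) : 0 <= s -> (forall n, (g n)%:R <= s * n%:R + 1) ->
  (gap_rate (fun n e => (@scale R e).+1 + g (n + scale e))%N <= s%:E)%E.
Proof.
move=> s0 gs; apply: ge_ereal_sup => _ [e _ <-].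
apply: le_trans (limn_einf_sup _) _; apply/lee_addgt0Pr => eta eta0.
apply: limn_esup_le_near.
(* [c] collects the terms independent of [n]: the gap is at most [s * n + c]. *)
pose c := (scale e).+1%:R + s * (scale e)%:R + 1.
exists (Num.truncn (c / eta)).+1 => // n /= cn.
have n0 : 0 < n%:R :> R by rewrite ltr0n; apply: leq_trans cn.
have cn' : c <= eta * n%:R.
  rewrite mulrC -ler_pdivrMr//; apply/ltW/(lt_le_trans (truncnS_gt _)).
  by rewrite ler_nat.
rewrite -EFinD lee_fin ler_pdivrMr// natrD.
have := gs (n + scale e)%N; rewrite natrD; move: cn'; rewrite /c.
by move: (g _)%:R => G; lra.
Qed.

End gap_rates.

Section entropy_gap.
Variables (R : realType) (g : nat -> nat) (sigma beta : R).
Hypotheses (g0 : g 0%N = 1%N) (le_g : forall n, sigma * n%:R <= (g n)%:R).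
Hypotheses (sigma_ge0 : 0 <= sigma) (sigma_beta : (1 + sigma)^-1 < beta).
Hypothesis beta_lt1 : beta < 1.

Let beta_gt0 : 0 < beta.
Proof. by apply: lt_trans sigma_beta; rewrite invr_gt0 ltr_wpDr. Qed.

(** For [t = beta * ln m] the ratio of the geometric series is [2 * m ^ ((1 + sigma)^-1 - beta)],
    and the assumption on [m] makes it less than 1. *)
Lemma h_top_B_Trans_le m : (0 < m)%N ->
  ln 2 < (beta - (1 + sigma)^-1) * ln m%:R ->
  (h_top_B (@left_shift R m g) (Trans (@left_shift R m g)) <= (beta * ln m%:R)%:E)%E.
Proof.
move=> m_gt0 m_big; apply: h_top_B_le => [|N e e0].
  by rewrite mulr_ge0 ?ln_ge0 ?ler1n// ltW.
apply: (@sparse_bowen_C_N_le0 R m g m_gt0 _ sigma) => // [x N0 xT|].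
  exact: (Trans_nonzeros g0 m_gt0 le_g).
rewrite -[X in X * _](@lnK R 2) ?posrE// -expRD expR_lt1.
by move: m_big; rewrite mulrBl [X in _ - X]mulrC; lra.
Qed.

(** All entropies are compared with [ln m]: that of [Trans] is at most [beta * ln m], while [h_top]
    is at least [ln m] and the entropy of [Rec] exceeds [beta * ln m]. *)
Lemma exists_entropy_gap : exists2 m, (0 < m)%N &
  let f := @left_shift R m g in
  [/\ (h_top_B f (Trans f) <= beta%:E * h_top f)%E,
      (beta%:E * h_top f < h_top f)%E &
      (h_top_B f (Trans f) < h_top_B f (Rec f))%E].
Proof.
pose c := beta - (1 + sigma)^-1; have c0 : 0 < c by rewrite subr_gt0.
pose m := (Num.truncn (expR (ln 2 / c))).+1.
have m0 : 0 < m%:R :> R by rewrite ltr0n.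
have m_big : ln 2 < c * ln m%:R.
  by rewrite mulrC -ltr_pdivrMr// -ltr_expR lnK ?posrE// truncnS_gt.
have lnm : 0 < ln m%:R :> R.
  by rewrite -(pmulr_rgt0 _ c0); apply: lt_trans m_big; rewrite ln_gt0// ltr1n.
have fin : h_top (@left_shift R m g) \is a fin_num by exact: h_top_fin.
have ge_m : ((ln m%:R)%:E <= h_top (@left_shift R m g))%E by exact: h_top_ge.
have le_T := @h_top_B_Trans_le m isT m_big.
exists m => // f; split.
- apply: le_trans le_T _; rewrite EFinM lee_pmul2l ?lte_fin//.
- rewrite -(fineK fin) -EFinM lte_fin; move: ge_m; rewrite -(fineK fin) lee_fin => ge_m.
  by rewrite gtr_pMl// (lt_le_trans lnm).
(* [Q > 2 / (1 - beta)] means [beta < 1 - 2 / Q]. *)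
pose Q := (Num.truncn (2 / (1 - beta))).+1.
apply: le_lt_trans le_T _; apply: (@lt_le_trans _ _ ((1 - 2 / Q%:R) * ln m%:R)%:E).
  rewrite lte_fin ltr_pM2r// ltrBrDr -ltrBrDl ltr_pdivrMr ?ltr0n//.
  by rewrite mulrC -ltr_pdivrMr ?subr_gt0// truncnS_gt.
exact: h_top_B_Rec_ge.
Qed.

End entropy_gap.

Lemma gap_shift_system (R : realType) m (g : nat -> nat) : g 0%N = 1%N -> (0 < m)%N ->
  topological_dynamical_system (@left_shift R m g).
Proof.
move=> g0 m_gt0; split.
- exact: gap_shift_compact.
- exact: left_shift_continuous.
exists (ones R g m_gt0), (zero_ones R g0 m_gt0).
move=> /(congr1 (fun x : gap_shift R m g => x 0%N)) /= /eqP.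
by rewrite (negPf (nonzero_letter_neq0 m_gt0)).
Qed.

Local Open Scope ereal_scope.

(* The inverse is that of \bar R, for which (1 + +oo)^-1 = 0. *)
Theorem theorem7 (R : realType) (tau : \bar R) (delta : R)
    (tau_gt0 : 0 < tau) (delta_gt0 : (0 < delta)%R)
    (delta_lt : delta%:E < 1 - (1 + tau)^-1) :
  exists (X : metricType R) (f : X -> X),
    [/\ topological_dynamical_system f,
        nonuniform_specification f tau,
        h_top_B f (Trans f) <= ((1 + tau)^-1 + delta%:E) * h_top f,
        ((1 + tau)^-1 + delta%:E) * h_top f < h_top f
      & h_top_B f (Trans f) < h_top_B f (Rec f)].
Proof.
case: tau tau_gt0 delta_lt => [s| |//] tau_gt0 delta_lt.
  have s0 : (0 < s)%R by [].
  have s1 : (0 < 1 + s)%R by rewrite addr_gt0.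
  have invE : (1 + s%:E)^-1 = ((1 + s)^-1)%:E by rewrite -EFinD inver gt_eqF.
  rewrite invE -EFinD; move: delta_lt; rewrite invE -EFinB lte_fin => delta_lt.
  (* This [g n] lies between [s * n] and [s * n + 1], so its rate is exactly [s]. *)
  pose g n := (Num.truncn (s * n%:R)).+1.
  have g0 : g 0%N = 1%N by rewrite /g mulr0 truncn0.
  have g_nd : {homo g : i j / (i <= j)%N}.
    by move=> i j ij; rewrite ltnS; apply: le_truncn; rewrite ler_pM2l ?ler_nat.
  have le_g n : (s * n%:R <= (g n)%:R)%R by apply/ltW/truncnS_gt.
  have g_le n : ((g n)%:R <= s * n%:R + 1)%R.
    by rewrite /g -natr1 lerD2r truncn_le// mulr_ge0// ltW.
  have [m m_gt0 [TB Blt BR]] := @exists_entropy_gap R g s ((1 + s)^-1 + delta)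
    g0 le_g (ltW s0) ltac:(by rewrite ltrDl) ltac:(by rewrite -ltrBrDl).
  have rate_ge M : gap_function (@left_shift R m g) M -> s%:E <= gap_rate M.
    by move=> MP; apply: (gap_rate_ge g0 g_nd m_gt0 MP); exact: nearW.
  exists (gap_shift R m g), (@left_shift R m g); split=> //.
    exact: gap_shift_system.
  split=> //; have GM := @gap_specification R m g g0 g_nd.
  eexists; first exact: GM.
  by apply/eqP; rewrite eq_le rate_ge// andbT gap_rate_le// ltW.
have invE : (1 + +oo)^-1 = 0 :> \bar R by rewrite addey// invey.
rewrite invE add0e; move: delta_lt; rewrite invE sube0 lte_fin => delta_lt.
(* The square gives an infinite rate. The factor [L > delta^-1] ensures [g n >= delta^-1 * n] for
   all [n], so [sigma = delta^-1] is possible, and [(1 + sigma)^-1 < delta]. *)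
pose L := (Num.truncn delta^-1).+1.
pose g n := (L * n ^ 2).+1.
have g0 : g 0%N = 1%N by rewrite /g muln0.
have g_nd : {homo g : i j / (i <= j)%N}.
  by move=> i j ij; rewrite ltnS leq_mul2l leq_exp2r// ij orbT.
have le_g (s : R) : \forall n \near \oo, (s * n%:R <= (g n)%:R)%R.
  exists (Num.truncn s).+1 => // n /= sn.
  apply: (@le_trans _ _ (n%:R * n%:R)%R).
    apply: ler_wpM2r => //; apply/ltW/(lt_le_trans (truncnS_gt _)).
    by rewrite ler_nat.
  by rewrite -natrM ler_nat /g mulnn; apply: leqW; rewrite leq_pmull.
have le_gL n : (delta^-1 * n%:R <= (g n)%:R)%R.
  apply: (@le_trans _ _ (L%:R * n%:R)%R).
    by apply: ler_wpM2r => //; apply/ltW/truncnS_gt.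
  by rewrite -natrM ler_nat /g; case: n => [|n]; nia.
have [m m_gt0 [TB Blt BR]] := @exists_entropy_gap R g delta^-1 delta
  g0 le_gL ltac:(by rewrite invr_ge0 ltW)
  ltac:(by rewrite -[ltRHS]invrK ltf_pV2 ?posrE ?invr_gt0 ?addr_gt0 ?invr_gt0// ltrDr) delta_lt.
have rate_ge M : gap_function (@left_shift R m g) M -> gap_rate M = +oo.
  move=> MP; apply: eq_infty => s.
  exact: (gap_rate_ge g0 g_nd m_gt0 MP (le_g s)).
exists (gap_shift R m g), (@left_shift R m g); split=> //.
  exact: gap_shift_system.
split=> [|M /rate_ge -> //]; have GM := @gap_specification R m g g0 g_nd.
by eexists; [exact: GM|exact: rate_ge].
Qed.
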